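(* For a nonnegative integer $n$, the number $b(n)$ of non-Rascoe partitions of $n$ is odd if and only if $n=m(5m+1)/2$ for some $m\in\mathbb{Z}$.
   Context: A non-Rascoe partition of a positive integer $n$ is a partition of $n$ into distinct parts in which the number of parts is not itself a part; the empty partition is counted as the unique non-Rascoe partition of $0$, so $b(0)=1$. *)

(* Defs.v *)
From mathcomp Require Import all_boot.

Set Implicit Arguments.
Unset Strict Implicit.
Unset Printing Implicit Defensive.

Definition partition_of (n : nat) (s : seq nat) : bool :=
  [&& sorted geq s, 0 \notin s & sumn s == n].

Definition non_rascoe (n : nat) (s : seq nat) : bool :=
  [&& partition_of n s, uniq s & size s \notin s].

(* A partition of n has at most n parts, each at most n, so it suffices to
   count among the finitely many sequences of that shape; partition_of_bseq
   below shows that none is missed or counted twice. *)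
Definition b (n : nat) : nat :=
  #|[set t : n.-bseq 'I_n.+1 | non_rascoe n [seq val i | i <- t]]|.

Lemma partition_of_bseq (n : nat) (s : seq nat) :
  partition_of n s -> exists! t : n.-bseq 'I_n.+1, [seq val i | i <- t] = s.
Proof.
case/and3P=> _ s0 /eqP sn.
have size_le : size s <= n.
  rewrite -sn; elim: s s0 {sn} => //= x s IHs.
  by rewrite inE negb_or eq_sym -lt0n => /andP[x0 /IHs les]; rewrite -add1n leq_add.
have all_le : all (fun x => x < n.+1) s.
  apply/allP=> x xs; rewrite ltnS -sn.
  by elim: s xs {s0 sn size_le} => //= y s IHs; rewrite inE;
    case/orP=> [/eqP-> | /IHs/leq_trans->//]; rewrite ?leq_addr ?leq_addl.
have inordK_s : [seq val i | i <- [seq (inord x : 'I_n.+1) | x <- s]] = s.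
  rewrite -map_comp -[RHS]map_id; apply/eq_in_map=> x xs /=.
  by rewrite inordK //; apply: (allP all_le).
have szt : size [seq (inord x : 'I_n.+1) | x <- s] <= n by rewrite size_map.
exists (Bseq szt); split=> //= t' t's.
by apply: val_inj; apply: (inj_map val_inj); rewrite /= inordK_s t's.
Qed.

(* Main.v *)
Require Import Defs.
From mathcomp Require Import all_boot all_order all_algebra.
From mathcomp Require Import ring zify.
Import GRing.Theory.

Set Implicit Arguments.
Unset Strict Implicit.
Unset Printing Implicit Defensive.

(** Let [D_a = q^(a(a+1)/2) / (q;q)_a] generate the partitions into [a] distinct
    parts. Repeatedly adding and removing the part [k] shows that those into
    [k] distinct parts avoiding [k] are generated by
    [sum_i (-1)^i q^(ik) D_(k-i)]. Summing over [k] and using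
    [sum_a x^a D_a = prod_(t >= 1) (1 + x q^t)] gives
    [sum_n b(n) q^n = sum_i (-1)^i q^(i^2) prod_(t > i) (1 + q^t)], which modulo 2
    is [(q;q)_oo sum_i q^(i^2) / (q;q)_i]. By the first Rogers-Ramanujan identity
    this is [sum_m (-1)^m q^(m(5m+1)/2)].

    All power series are evaluated at an element [q] of a commutative ring with
    [q^(N+1) = 0], so that every sum and product is finite; the coefficient of
    [q^n] is read off in [F_2[X]/(X^(n+1))]. *)

(** * Non-Rascoe partitions as sets of parts *)

(* The index [i : 'I_n] stands for the part [i + 1]. *)
Definition non_rascoe_set (n : nat) (A : {set 'I_n}) : bool :=
  [forall i in A, i.+1 != #|A|].

Lemma sorted_geq_uniq_inj (s t : seq nat) :
  sorted geq s -> sorted geq t -> uniq s -> uniq t -> s =i t -> s = t.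
Proof.
move=> ss st us ut st_eq; apply: (@sorted_eq _ geq) => //.
- by move=> y x z /= yx zy; apply: leq_trans zy yx.
- by move=> x y /= /andP[yx xy]; apply/eqP; rewrite eqn_leq xy.
- exact: uniq_perm.
Qed.

(** Distinct parts of a partition of [n] lie between 1 and [n], so they form a subset of ['I_n];
    sorting recovers the sequence. *)
Lemma b_set (n : nat) :
  b n = #|[set A : {set 'I_n} | non_rascoe_set A & (\sum_(i in A) i.+1 == n)%N]|.
Proof.
pose vs (t : n.-bseq 'I_n.+1) := [seq val i | i <- t].
pose f (t : n.-bseq 'I_n.+1) := [set i : 'I_n | i.+1 \in vs t].
pose parts (A : {set 'I_n}) := [seq (val i).+1 | i <- enum A].
have partsP t : non_rascoe n (vs t) -> perm_eq (parts (f t)) (vs t).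
  case/and3P=> /and3P[_ t0 _] ut _; apply: uniq_perm => //.
    by rewrite map_inj_uniq ?enum_uniq // => i j [/val_inj].
  move=> x; apply/mapP/idP => [[i]|xt]; first by rewrite mem_enum inE => ? ->.
  have /mapP[y yt xy] := xt; have x0 : x != 0%N by apply: contraNneq t0 => <-.
  have xn : x.-1 < n by rewrite -ltnS prednK ?lt0n // xy; apply: ltn_ord.
  by exists (Ordinal xn); rewrite ?mem_enum ?inE /= prednK ?lt0n.
have size_parts A : size (parts A) = #|A| by rewrite size_map cardE.
have sum_parts A : sumn (parts A) = (\sum_(i in A) i.+1)%N.
  by rewrite sumnE big_map big_enum.
have mem_parts (A : {set 'I_n}) : (#|A| \in parts A) = ~~ non_rascoe_set A.
  rewrite /non_rascoe_set negb_forall_in.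
  apply/mapP/exists_inP => [[i]|[i iA /negbNE/eqP Ai]].
    by rewrite mem_enum => iA ->; exists i; rewrite // negbK.
  by exists i; rewrite ?mem_enum.
have uniq_parts A : uniq (parts A).
  by rewrite map_inj_uniq ?enum_uniq // => i j [/val_inj].
rewrite /b -(card_in_imset (f := f)) => [|t u]; last first.
  rewrite !inE => Pt Pu ftu; have pt := partsP t Pt; have pu := partsP u Pu.
  apply/val_inj/(inj_map val_inj); case/and3P: Pt Pu => /and3P[st _ _] ut _.
  case/and3P=> /and3P[su _ _] uu _; apply: sorted_geq_uniq_inj => // x.
  by rewrite -(perm_mem pt) ftu (perm_mem pu).
apply: eq_card => A; rewrite !inE; apply/imsetP/andP => [[t]|[nrA sA]].
  rewrite inE => Pt ->; have pt := partsP t Pt; case/and3P: Pt.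
  case/and3P=> _ _ sn ut szt; rewrite -sum_parts (perm_sumn pt); split=> //.
  by apply: contraNT szt; rewrite -mem_parts -size_parts (perm_size pt) (perm_mem pt).
have pA : perm_eq (sort geq (parts A)) (parts A) by rewrite perm_sort.
have part_A : partition_of n (sort geq (parts A)).
  apply/and3P; split; first by apply: sort_sorted => x y /=; apply: leq_total.
    by rewrite (perm_mem pA); apply/mapP => -[].
  by rewrite (perm_sumn pA) sum_parts.
have [t [vt _]] := partition_of_bseq part_A; exists t.
  rewrite inE /non_rascoe vt part_A (perm_uniq pA) uniq_parts (perm_mem pA).
  by rewrite (perm_size pA) size_parts mem_parts nrA.
apply/setP=> i; rewrite inE /vs vt (perm_mem pA).
by rewrite mem_map ?mem_enum // => j k [/val_inj].
Qed.

Local Open Scope ring_scope.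

(** * The first Rogers-Ramanujan identity for nilpotent [q] *)

Lemma expr_nilp (R : pzSemiRingType) (q : R) N i :
  q ^+ N.+1 = 0 -> (N < i)%N -> q ^+ i = 0.
Proof. by move=> q0 /subnK <-; rewrite exprD q0 mulr0. Qed.

(* [(q^(m+1); q)_s] *)
Definition qpoch (R : comNzRingType) (q : R) (m s : nat) : R :=
  \prod_(j < s) (1 - q ^+ (m + j).+1).

Lemma qpochSr (R : comNzRingType) (q : R) m s :
  qpoch q m s.+1 = qpoch q m s * (1 - q ^+ (m + s).+1).
Proof. by rewrite /qpoch big_ord_recr. Qed.

Lemma qpochSl (R : comNzRingType) (q : R) m s :
  qpoch q m s.+1 = (1 - q ^+ m.+1) * qpoch q m.+1 s.
Proof.
rewrite /qpoch big_ord_recl addn0; congr (_ * _).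
by apply: eq_bigr => j _; rewrite /= /bump /= add1n addnS addSn.
Qed.

Lemma qpoch_nilp (R : comNzRingType) (q : R) N m s :
  q ^+ N.+1 = 0 -> (N <= m + s)%N -> qpoch q m s.+1 = qpoch q m s.
Proof. by move=> q0 Nms; rewrite qpochSr (expr_nilp q0) // subr0 mulr1. Qed.

(* [(q;q)_oo sum_i z^i q^(i^2) / (q;q)_i] at [z = q^s]: since [q^t = 0] for [t > N],
   [qpoch q i N] is the infinite product [(q^(i+1);q)_oo]. *)
Definition rr_sum (R : comNzRingType) (q : R) (N s : nat) : R :=
  \sum_(i < N.+1) q ^+ (i * s + i * i) * qpoch q i N.

(* Rogers' expansion of the same series at [z = q^s]; for [s = 0] the exponents are
   [m(5m+1)/2] and [(m+1)(5m+4)/2], which are the values of [m(5m+1)/2] at [m] and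
   [-(m+1)]. *)
Definition rr_theta (R : comNzRingType) (q : R) (N s : nat) : R :=
  \sum_(m < N.+1) (-1) ^+ m * q ^+ (m * s * 2 + 'C(m, 2) * 5 + m * 3)
    * (1 - q ^+ (s * 2 + m * 4 + 2)) * qpoch q m s.

(** Subtracting gives term [i] a factor [1 - q^i]: term 0 vanishes, and [qpochSl] turns term [i + 1]
    into [q^(s+1)] times term [i] at [s + 2]. *)
Lemma rr_sum_rec (R : comNzRingType) (q : R) N s : q ^+ N.+1 = 0 ->
  rr_sum q N s = rr_sum q N s.+1 + q ^+ s.+1 * rr_sum q N s.+2.
Proof.
move=> q0; apply/eqP; rewrite [X in _ == X]addrC -subr_eq -sumrB; apply/eqP.
rewrite big_ord_recl /rr_sum mulr_sumr [RHS]big_ord_recr /=.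
rewrite !mul0n subrr add0r [X in _ + X]mulrA -exprD.
rewrite (@expr_nilp _ q N (_ + (_ + _))) //; last first.
  by rewrite mulnS; lia.
rewrite mul0r addr0; apply: eq_bigr => i _; rewrite /bump add1n.
rewrite -(qpoch_nilp q0 (leq_addl i N)) qpochSl.
rewrite !(mulSn, mulnS, addnS, addSn, exprS, exprD).
ring.
Qed.

(** Shortens the product, so that the series at [s] and [s + 1] share the factor [qpoch q m s] term
    by term. *)
Lemma rr_thetaS (R : comNzRingType) (q : R) N s : q ^+ N.+1 = 0 ->
  rr_theta q N s.+1 =
    \sum_(m < N.+1) (-1) ^+ m * q ^+ (m * s * 2 + 'C(m, 2) * 5 + m * 4)
      * (1 - q ^+ (s + m * 2).+1) * qpoch q m s.
Proof.
(* The summands differ by [D (m+1) - D m]; [D 0] vanishes by [1 - q^0], and [D (N+1)] because its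
   exponent exceeds [N]. *)
move=> q0; pose D m := (-1) ^+ m * q ^+ (m * s * 2 + 'C(m, 2) * 5 + m * 4)
  * (1 - q ^+ m) * qpoch q m s.
apply/eqP; rewrite -subr_eq0 -sumrB.
rewrite (eq_bigr (fun m : 'I__ => D m.+1 - D m)); last first.
  move=> m _; rewrite /D binS bin1.
  rewrite -[_ * qpoch q m.+1 s]mulrA -qpochSl qpochSr.
  rewrite !(mulSn, mulnS, muln0, addn0, addnS, addSn, exprS, exprD).
  ring.
rewrite -(big_mkord xpredT (fun m => D m.+1 - D m)) telescope_sumr //.
rewrite /D subrr mulr0 mul0r subr0 (@expr_nilp _ q N) ?(mulr0, mul0r) //.
by rewrite (leq_trans _ (leq_addl _ _)) // leq_pmulr.
Qed.

Lemma rr_theta_rec (R : comNzRingType) (q : R) N s : q ^+ N.+1 = 0 ->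
  rr_theta q N s = rr_theta q N s.+1 + q ^+ s.+1 * rr_theta q N s.+2.
Proof.
(* [K] telescopes likewise: [1 - q^(m+1)] times [qpoch q m.+1 s] is [qpoch q m s.+1], a multiple of
   [qpoch q m s]. *)
move=> q0; pose K m := - (-1) ^+ m * q ^+ (m * s * 2 + 'C(m, 2) * 5 + m * 3)
  * (1 - q ^+ m) * qpoch q m s.
apply/eqP; rewrite !rr_thetaS // -subr_eq0 opprD addrA mulr_sumr -!sumrB.
rewrite (eq_bigr (fun m : 'I__ => K m.+1 - K m)); last first.
  move=> m _; rewrite /K binS bin1.
  rewrite -[_ * qpoch q m.+1 s]mulrA -qpochSl qpochSr.
  rewrite !(mulSn, mulnS, muln0, addn0, addnS, addSn, exprS, exprD).
  ring.
rewrite -(big_mkord xpredT (fun m => K m.+1 - K m)) telescope_sumr //.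
rewrite /K subrr mulr0 mul0r subr0 (@expr_nilp _ q N) ?(mulr0, mul0r) //.
by rewrite (leq_trans _ (leq_addl _ _)) // leq_pmulr.
Qed.

(* Both sides satisfy [F s = F (s+1) + q^(s+1) F (s+2)] and equal [(q;q)_N] for
   [s >= N], hence agree by descending induction on [s]. *)
Lemma rogers_ramanujan_nilp (R : comNzRingType) (q : R) N s :
  q ^+ N.+1 = 0 -> rr_sum q N s = rr_theta q N s.
Proof.
move=> q0; have [k] := ubnP (N - s); elim: k s => // k IHk s.
rewrite ltnS => Nsk; have [Ns|sN] := leqP N s.
  rewrite /rr_sum big_ord_recl big1 => [|i _]; last first.
    by rewrite (@expr_nilp _ q N _ q0) ?mul0r //= /bump /=; nia.
  rewrite /rr_theta big_ord_recl big1 => [|i _]; last first.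
    by rewrite (@expr_nilp _ q N _ q0) ?mulr0 ?mul0r //= /bump /=; nia.
  rewrite (@expr_nilp _ q N (_ + 2)); [|exact: q0|by rewrite /=; lia].
  rewrite /= !mul0n !expr0 !mulr1 subr0 mulr1 !mul1r !addr0 -(subnKC Ns).
  elim: (s - N)%N => [|d IHd]; first by rewrite addn0.
  by rewrite addnS (qpoch_nilp q0) // add0n leq_addr.
rewrite rr_sum_rec // rr_theta_rec // !IHk //; lia.
Qed.

(** * The generating function of non-Rascoe partitions *)

Lemma prod_linearE (R : comNzRingType) (I : finType) (c : I -> R) :
  \prod_i (1 + c i *: 'X) =
    \sum_(A : {set I}) (\prod_(i in A) c i) *: 'X^#|A|.
Proof.
under eq_bigr do rewrite addrC.
rewrite bigA_distr; apply: eq_bigr => A _.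
by rewrite -big_mkcond /= scaler_prod prodr_const.
Qed.

(* The coefficient of ['X^a] in [distinct_poly] generates the partitions into [a] distinct
   parts at most [N]; [avoid_poly] moreover forbids the part [k]. *)
Definition distinct_poly (R : comNzRingType) (q : R) (N : nat) : {poly R} :=
  \prod_(i < N) (1 + q ^+ i.+1 *: 'X).

Definition avoid_poly (R : comNzRingType) (q : R) (N k : nat) : {poly R} :=
  \prod_(i < N | i.+1 != k) (1 + q ^+ i.+1 *: 'X).

(** For a set of [k] parts, non-Rascoe means avoiding the part [k]; weight 0 on that part discards
    the other sets. *)
Lemma coef_avoid_poly (R : comNzRingType) (q : R) N k :
  (avoid_poly q N k)`_k =
  \sum_(A : {set 'I_N} | non_rascoe_set A && (#|A| == k))
    q ^+ (\sum_(i in A) i.+1).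
Proof.
pose c (i : 'I_N) := if i.+1 != k then q ^+ i.+1 else 0.
rewrite /avoid_poly big_mkcond (eq_bigr (fun i => 1 + c i *: 'X)) => [|i _]; last first.
  by rewrite /c; case: ifP => // _; rewrite scale0r addr0.
rewrite prod_linearE coef_sum [RHS]big_mkcond; apply: eq_bigr => A _.
rewrite coefZ coefXn andbC (eq_sym k); case: eqP => [Ak|_]; last by rewrite mulr0.
rewrite mulr1 /=; case: ifPn => [/forall_inP nrA|].
  by rewrite -prodrXr; apply: eq_bigr => i iA; rewrite /c -Ak nrA.
rewrite /non_rascoe_set negb_forall_in => /exists_inP[i iA /negbNE/eqP iAk].
by rewrite (bigD1 i) //= /c iAk Ak eqxx mul0r.
Qed.

Lemma avoid_poly_rec (R : comNzRingType) (q : R) N k : (0 < k <= N)%N ->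
  distinct_poly q N = (1 + q ^+ k *: 'X) * avoid_poly q N k.
Proof.
by case: k => // k kN; rewrite /distinct_poly (bigD1 (Ordinal kN)).
Qed.

Lemma coef0_linear_prod (R : comNzRingType) (I : finType) (P : pred I) (c : I -> R) :
  (\prod_(i | P i) (1 + c i *: 'X))`_0 = 1.
Proof.
by rewrite -horner_coef0 horner_prod big1 // => i _; rewrite !hornerE.
Qed.

(** Dividing by [1 + q^k X] is multiplying by the geometric series in [- q^k X]. *)
Lemma coef_avoid_polyE (R : comNzRingType) (q : R) N k j : (0 < k <= N)%N ->
  (avoid_poly q N k)`_j = \sum_(i < j.+1) (- q ^+ k) ^+ i * (distinct_poly q N)`_(j - i).
Proof.
move=> kN; elim: j => [|j IHj].
  by rewrite big_ord1 expr0 mul1r !coef0_linear_prod.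
rewrite big_ord_recl expr0 mul1r subn0.
rewrite {1}(avoid_poly_rec _ kN) mulrDl mul1r coefD -scalerAl coefZ coefXM /=.
under eq_bigr do rewrite exprS -mulrA.
by rewrite -mulr_sumr -IHj; ring.
Qed.

Lemma size_distinct_poly (R : comNzRingType) (q : R) N :
  (size (distinct_poly q N) <= N.+1)%N.
Proof.
rewrite /distinct_poly prod_linearE (leq_trans (size_sum _ _ _)) //.
apply/bigmax_leqP => A _; rewrite (leq_trans (size_scale_leq _ _)) // size_polyXn.
by rewrite ltnS -[X in (_ <= X)%N]card_ord max_card.
Qed.

Lemma sum_non_rascoe_set (R : comNzRingType) (q : R) N : q ^+ N.+1 = 0 ->
  \sum_(A : {set 'I_N} | non_rascoe_set A) q ^+ (\sum_(i in A) i.+1) =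
  \sum_(i < N.+1) (-1) ^+ i * q ^+ (i * i) * \prod_(j < N) (1 + q ^+ (i + j).+1).
Proof.
move=> q0.
rewrite (partition_big (fun A : {set 'I_N} => inord #|A| : 'I_N.+1) xpredT) //=.
have cardA (A : {set 'I_N}) (k : 'I_N.+1) : (inord #|A| == k) = (#|A| == k).
  by rewrite -val_eqE /= inordK // ltnS -[X in (_ <= X)%N]card_ord max_card.
pose d i := (distinct_poly q N)`_i.
transitivity (\sum_(k < N.+1) \sum_(i < N.+1 | (i <= k)%N)
   (-1) ^+ i * (q ^+ (i * k) * d (k - i)%N)).
  apply: eq_bigr => k _; under eq_bigl do rewrite cardA.
  rewrite -coef_avoid_poly.
  pose G i := (-1) ^+ i * (q ^+ (i * k) * d (k - i)%N).
  rewrite [RHS](_ : _ = \sum_(i < k.+1) G i); last first.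
    by rewrite (big_ord_widen N.+1 G (ltn_ord k)).
  (* There is no part 0, hence no factor to divide out when [k = 0]. *)
  case: (posnP k) => [k0|k0].
    by rewrite k0 big_ord1 /G k0 !expr0 !mul1r /d subn0 !coef0_linear_prod.
  rewrite coef_avoid_polyE; last by rewrite k0 -ltnS ltn_ord.
  by apply: eq_bigr => i _; rewrite /G [in LHS]exprNn -exprM mulnC -mulrA.
rewrite (exchange_big_dep xpredT) //=; apply: eq_bigr => i _.
(* With [a = k - i], the sum over [k] becomes an evaluation of [distinct_poly] at [q^i]. *)
transitivity ((-1) ^+ i * q ^+ (i * i) * (distinct_poly q N).[q ^+ i]); last first.
  rewrite horner_prod; congr (_ * _); apply: eq_bigr => j _.
  by rewrite !hornerE -exprD addSn addnC.
rewrite (horner_coef_wide _ (size_distinct_poly q N)) -mulr_sumr -mulrA.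
congr (_ * _); rewrite mulr_sumr.
rewrite -(big_geq_mkord i N.+1 xpredT (fun k => q ^+ (i * k) * d (k - i)%N)).
rewrite -(big_mkord xpredT (fun a => q ^+ (i * i) * (d a * (q ^+ i) ^+ a))).
rewrite -{1}[i : nat]add0n big_addn.
(* The evaluation has extra terms with [a > N - i]; these need [i > 0], so [i * i + i * a > N] and
   they vanish. *)
rewrite [RHS](@big_cat_nat _ _ _ (N.+1 - i)) ?leq_subr //= [X in _ = _ + X]big_nat_cond.
rewrite [X in _ = _ + X]big1 ?addr0 => [|a]; last first.
  case/andP => /andP[aN aN'] _.
  rewrite [d a * _]mulrC mulrA -exprM -exprD (expr_nilp q0) ?mul0r //.
  by rewrite leq_subLR in aN; case: (i : nat) aN aN' => [|j]; nia.
apply: eq_bigr => a _.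
by rewrite addnK mulnDr exprD exprM; ring.
Qed.

(** * Reduction modulo 2 *)

Lemma sum_non_rascoe_set_pchar2 (R : comNzRingType) (q : R) N :
  2 \in [pchar R] -> q ^+ N.+1 = 0 ->
  \sum_(A : {set 'I_N} | non_rascoe_set A) q ^+ (\sum_(i in A) i.+1) =
  \sum_(m < N.+1) (q ^+ ('C(m, 2) * 5 + m * 3)
    + q ^+ ('C(m, 2) * 5 + m * 3 + (m * 4 + 2))).
Proof.
move=> R2 q0; have signE i : (-1 : R) ^+ i = 1 by rewrite oppr_pchar2 // expr1n.
rewrite sum_non_rascoe_set //; transitivity (rr_sum q N 0).
  apply: eq_bigr => i _; rewrite signE mul1r muln0; congr (_ * _).
  by apply: eq_bigr => j _; rewrite oppr_pchar2.
rewrite rogers_ramanujan_nilp //; apply: eq_bigr => m _.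
rewrite signE /qpoch big_ord0 mul1r mulr1 muln0 oppr_pchar2 //.
by rewrite mulrDr mulr1 -exprD.
Qed.

Lemma in_qpoly_Xn_eq0 (R : comNzRingType) N (p : {poly R}) :
  in_qpoly 'X^(N.+1) p = 0 -> p`_N = 0.
Proof.
move/(congr1 val) => /= p0.
rewrite (Pdiv.RingMonic.rdivp_eq (monicXn R N.+1) p).
by move: p0; rewrite mk_monic_Xn => ->; rewrite addr0 coefMXn ltnSn.
Qed.

(** The coefficient of [q^n] in the theta series stripped of its signs. *)
Definition theta_count (n : nat) : nat :=
  \sum_(m < n.+1) (('C(m, 2) * 5 + m * 3 == n)
    + ('C(m, 2) * 5 + m * 3 + (m * 4 + 2) == n)).

Lemma odd_b (n : nat) : odd (b n) = odd (theta_count n).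
Proof.
have F2 : 2 \in [pchar 'F_2] by apply: pchar_Fp.
pose h : {poly 'F_2} := 'X^(n.+1).
have R2 : 2 \in [pchar {poly %/ h}] by rewrite pchar_qpoly.
have q0 : in_qpoly h 'X ^+ n.+1 = 0.
  by rewrite -rmorphXn; apply/val_inj; rewrite /= mk_monic_Xn Pdiv.RingMonic.rmodpp ?monicXn.
have := sum_non_rascoe_set_pchar2 R2 q0.
under eq_bigr do rewrite -rmorphXn.
under [RHS]eq_bigr do rewrite -!rmorphXn -rmorphD.
rewrite -!rmorph_sum => /eqP; rewrite -subr_eq0 -rmorphB => /eqP /in_qpoly_Xn_eq0.
rewrite coefB !coef_sum => /eqP; rewrite subr_eq0.
rewrite [X in X == _](_ : _ = (b n)%:R); last first.
  rewrite b_set -sum1_card natr_sum big_mkcond [RHS]big_mkcond /=.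
  apply: eq_bigr => A _; rewrite inE coefXn eq_sym.
  by case: (non_rascoe_set A) => //=; case: eqP.
rewrite [X in _ == X](_ : _ = (theta_count n)%:R); last first.
  rewrite natr_sum; apply: eq_bigr => m _.
  by rewrite coefD !coefXn natrD ![n == _]eq_sym.
have parity k : odd k = (k%:R != 0 :> 'F_2).
  by rewrite -(dvdn_pcharf F2) dvdn2 negbK.
by rewrite !parity => /eqP ->.
Qed.

(** * Exponents of the theta series *)

Lemma bin2_double m : ('C(m, 2) * 2 + m = m * m)%N.
Proof. by elim: m => // m IHm; rewrite binS bin1; lia. Qed.

(** The exponents are pairwise distinct, so the count is 0 or 1. *)
Lemma odd_theta_count (n : nat) :
  odd (theta_count n) <->
  exists m : nat, (n * 2 = m * (m * 5 + 1) \/ n * 2 = m.+1 * (m * 5 + 4))%N.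
Proof.
pose t m := (('C(m, 2) * 5 + m * 3 == n) + ('C(m, 2) * 5 + m * 3 + (m * 4 + 2) == n))%N.
have tE m : (0 < t m)%N <-> (n * 2 = m * (m * 5 + 1) \/ n * 2 = m.+1 * (m * 5 + 4))%N.
  by rewrite /t; have := bin2_double m; do 2 case: eqP => /=; lia.
have t1 m : (t m <= 1)%N by rewrite /t; do 2 case: eqP => /=; lia.
(* Doubled exponents increase: [m(5m+1) < (m+1)(5m+4) < (m+1)(5m+6)], the last being the first one
   for [m + 1]. *)
have tI m k : (0 < t m)%N -> (0 < t k)%N -> m = k.
  move=> /tE tm /tE tk; have [mk|km|//] := ltngtP m k.
    by have := leq_mul mk mk; lia.
  by have := leq_mul km km; lia.
split=> [/odd_gt0|[m /tE tm]].
  rewrite lt0n sum_nat_eq0 negb_forall => /existsP[m]; rewrite /= -lt0n.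
  by move/tE; exists m.
have mn : (m < n.+1)%N by have := bin2_double m; move/tE: tm; lia.
rewrite /theta_count (bigD1 (Ordinal mn)) //= -/(t m) big1 => [|k].
  by rewrite addn0; case: (t m) (t1 m) tm => [|[|]].
rewrite -val_eqE /= -/(t k) => km; apply/eqP; rewrite -leqn0 leqNgt.
by apply: contraNN km => tk; rewrite (tI _ _ tk tm).
Qed.

Lemma pentagonal5_int (n : nat) (m : int) :
  n%:R = m%:~R * (5 * m%:~R + 1) / 2 :> rat <-> n%:Z * 2 = m * (5 * m + 1).
Proof.
have -> : m%:~R * (5 * m%:~R + 1) = (m * (5 * m + 1))%:~R :> rat.
  by rewrite !(intrM, intrD).
split=> [nE|<-]; last by rewrite intrM mulfK.
by apply/(@intr_inj rat); rewrite [LHS]intrM [n%:~R]nE divfK.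
Qed.

Theorem theorem1p3 (n : nat) :
  odd (b n) <->
  exists m : int, n%:R = m%:~R * (5 * m%:~R + 1) / 2 :> rat.
Proof.
rewrite odd_b; apply: (iff_trans (odd_theta_count n)); split.
  case=> m [nE|nE]; [exists m%:Z | exists (- m.+1%:Z)]; apply/pentagonal5_int; lia.
(* [Negz m] is [-(m+1)], so the same [m] serves in both cases. *)
case=> m /pentagonal5_int nE; case: m nE => m nE; exists m; [left | right]; lia.
Qed.
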